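(* Let $n\ge 2$, let $H$ and $K$ be $n$-Hilbert spaces over the same field, let $a_2,\dots,a_n\in H$ be linearly independent and $b_2,\dots,b_n\in K$ be linearly independent. Let $\{p_i\}_{i=1}^\infty$ be a sequence in $H$ and $\{q_j\}_{j=1}^\infty$ a sequence in $K$. Then $\{p_i\otimes q_j\}_{i,j=1}^\infty\subseteq H\otimes K$ is a frame associated to $(a_2\otimes b_2,\dots,a_n\otimes b_n)$ for $H\otimes K$ if and only if $\{p_i\}_{i=1}^\infty$ is a frame associated to $(a_2,\dots,a_n)$ for $H$ and $\{q_j\}_{j=1}^\infty$ is a frame associated to $(b_2,\dots,b_n)$ for $K$.
   Context: Let $\mathbb K$ be $\mathbb R$ or $\mathbb C$. An $n$-inner product on a $\mathbb K$-linear space $H$ with $\dim H\ge n$ is a map $\langle\cdot,\cdot\,|\,\cdot,\dots,\cdot\rangle:H^{n+1}\to\mathbb K$ such that for all $x,y,z,x_1,\dots,x_n\in H$ and $\alpha\in\mathbb K$: (i) $\langle x_1,x_1|x_2,\dots,x_n\rangle\ge 0$, with equality iff $x_1,\dots,x_n$ are linearly dependent; (ii) $\langle x,y|x_2,\dots,x_n\rangle=\langle x,y|x_{i_2},\dots,x_{i_n}\rangle$ for every permutation $(i_2,\dots,i_n)$ of $(2,\dots,n)$; (iii) $\langle x,y|x_2,\dots,x_n\rangle=\overline{\langle y,x|x_2,\dots,x_n\rangle}$; (iv) $\langle\alpha x,y|x_2,\dots,x_n\rangle=\alpha\langle x,y|x_2,\dots,x_n\rangle$; (v) $\langle x+y,z|x_2,\dots,x_n\rangle=\langle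 x,z|x_2,\dots,x_n\rangle+\langle y,z|x_2,\dots,x_n\rangle$. The induced $n$-norm is $\|x_1,\dots,x_n\|=\sqrt{\langle x_1,x_1|x_2,\dots,x_n\rangle}$. $H$ is an $n$-Hilbert space if every sequence $\{x_k\}$ with $\lim_{l,k\to\infty}\|x_l-x_k,e_2,\dots,e_n\|=0$ for all $e_2,\dots,e_n\in H$ has some $x\in H$ with $\lim_k\|x_k-x,e_2,\dots,e_n\|=0$ for all $e_2,\dots,e_n\in H$. A sequence $\{p_i\}$ in $H$ is a frame associated to $(a_2,\dots,a_n)$ for $H$ if there are constants $0<A\le B<\infty$ (frame bounds) with $A\|p,a_2,\dots,a_n\|^2\le\sum_{i=1}^\infty|\langle p,p_i|a_2,\dots,a_n\rangle|^2\le B\|p,a_2,\dots,a_n\|^2$ for all $p\in H$. Denote the $n$-inner products and $n$-norms of $H$, $K$ with subscripts $1$, $2$. On $H\otimes K$ one puts, for $f_k\in H$, $g_k\in K$, $\langle f_1\otimes g_1,f_2\otimes g_2\,|\,f_3\otimes g_3,\dots,f_{n+1}\otimes g_{n+1}\rangle=\langle f_1,f_2|f_3,\dots,f_{n+1}\rangle_1\langle g_1,g_2|g_3,\dots,g_{n+1}\rangle_2$ and $\|f_1\otimes g_1,\dots,f_n\otimes g_n\|=\|f_1,\dots,f_n\|_1\|g_1,\dots,g_n\|_2$. The sequence $\{p_i\otimes q_j\}_{i,j}$ is a frame associated to $(a_2\otimes b_2,\dots,a_n\otimes b_n)$ for $H\otimes K$ if there are constants $0<A\le B<\infty$ such that,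 for all $p\otimes q$ with $p\in H$, $q\in K$, $A\|p\otimes q,a_2\otimes b_2,\dots,a_n\otimes b_n\|^2\le\sum_{i,j=1}^\infty|\langle p\otimes q,p_i\otimes q_j|a_2\otimes b_2,\dots,a_n\otimes b_n\rangle|^2\le B\|p\otimes q,a_2\otimes b_2,\dots,a_n\otimes b_n\|^2$. *)

(* Defs.v *)
From HB Require Import structures.
From mathcomp Require Import all_boot all_order all_algebra all_fingroup.
From mathcomp Require Import complex.
From mathcomp Require Import all_classical all_reals all_analysis.
Set Implicit Arguments.
Unset Strict Implicit.
Unset Printing Implicit Defensive.
Import Order.TTheory GRing.Theory Num.Theory.
Import numFieldNormedType.Exports.
Local Open Scope classical_set_scope.
Local Open Scope ring_scope.

Variant base_field := RealField | ComplexField.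

Definition RorC (R : realType) (k : base_field) : numFieldType :=
  match k with RealField => R | ComplexField => R[i] end.

Definition RorC_conj (R : realType) (k : base_field) :
    RorC R k -> RorC R k :=
  match k with
  | RealField => fun z => z
  | ComplexField => fun z : R[i] => Num.conj z
  end.

Definition RorC_re (R : realType) (k : base_field) : RorC R k -> R :=
  match k with
  | RealField => fun z => z
  | ComplexField => fun z : R[i] => complex.Re z
  end.

(* `|z| lives in the field itself (in R[i] for complex z); this is the modulus
   as a real number. *)
Definition modulus (R : realType) (k : base_field) (z : RorC R k) : R :=
  RorC_re `|z|.

(* Spaces may be infinite dimensional, so [free] (for vectType) is unavailable. *)
Definition lin_dep (F : fieldType) (V : lmodType F) (m : nat)
    (x : m.-tuple V) : Prop :=
  exists c : 'I_m -> F,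
    (exists i, c i != 0) /\ \sum_(i < m) c i *: tnth x i = 0.

Section NInnerProduct.
Variables (R : realType) (k : base_field) (n : nat) (H : lmodType (RorC R k)).
(* [ip x y [tuple x2; ...; xn]] stands for <x, y | x2, ..., xn>. *)
Variable ip : H -> H -> n.-1.-tuple H -> RorC R k.

(* In the order of R[i], 0 <= z means that z is real and nonnegative. *)
Record is_n_inner_product : Prop := IsNInnerProduct {
  nip_dim : exists e : n.-tuple H, ~ lin_dep e;
  nip_ge0 : forall x t, 0 <= ip x x t;
  nip_eq0 : forall x t, ip x x t = 0 <-> lin_dep [tuple of x :: t];
  nip_perm : forall x y t (s : 'S_(n.-1)),
    ip x y t = ip x y [tuple tnth t (s i) | i < n.-1];
  nip_conj : forall x y t, ip x y t = RorC_conj (ip y x t);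
  nip_scale : forall (c : RorC R k) x y t, ip (c *: x) y t = c * ip x y t;
  nip_add : forall x y z t, ip (x + y) z t = ip x z t + ip y z t
}.

Definition nnorm (x : H) (t : n.-1.-tuple H) : R :=
  Num.sqrt (RorC_re (ip x x t)).

Definition is_n_hilbert : Prop :=
  is_n_inner_product /\
  forall x : nat -> H,
    (forall t, nnorm (x lm.1 - x lm.2) t @[lm --> (\oo, \oo)] --> (0 : R)) ->
    exists y : H, forall t, nnorm (x m - y) t @[m --> \oo] --> (0 : R).

Definition is_frame (a : n.-1.-tuple H) (p : nat -> H) : Prop :=
  exists A B : R, [/\ 0 < A, A <= B & forall x : H,
    ((A * nnorm x a ^+ 2)%:E
       <= \sum_(0 <= i <oo) (modulus (ip x (p i) a) ^+ 2)%:E)%E /\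
    (\sum_(0 <= i <oo) (modulus (ip x (p i) a) ^+ 2)%:E
       <= (B * nnorm x a ^+ 2)%:E)%E].

End NInnerProduct.

(* Algebraic tensor product, up to unique isomorphism. *)
Definition is_tensor_product (F : fieldType) (H K T : lmodType F)
    (tens : {bilinear H -> K -> T}) : Prop :=
  forall (V : lmodType F) (b : {bilinear H -> K -> V}),
    exists phi : {linear T -> V}, (forall f g, phi (tens f g) = b f g) /\
      forall psi : {linear T -> V},
        (forall f g, psi (tens f g) = b f g) -> psi =1 phi.

Definition tensor_tuple (F : fieldType) (H K T : lmodType F)
    (tens : {bilinear H -> K -> T}) (m : nat)
    (f : m.-tuple H) (g : m.-tuple K) : m.-tuple T :=
  [tuple tens (tnth f i) (tnth g i) | i < m].

Section Tensor.
Variables (R : realType) (k : base_field) (n : nat).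
Variables (H K T : lmodType (RorC R k)) (tens : {bilinear H -> K -> T}).
Variables (ip1 : H -> H -> n.-1.-tuple H -> RorC R k)
          (ip2 : K -> K -> n.-1.-tuple K -> RorC R k)
          (ipT : T -> T -> n.-1.-tuple T -> RorC R k).

(* Only the values on simple tensors are prescribed. [ipT] is not required to
   satisfy [is_n_inner_product]: it vanishes at simple tensors whose H-components
   are dependent, even when the tensors themselves are independent. *)
Definition is_tensor_ip : Prop :=
  forall (f1 f2 : H) (g1 g2 : K) (f : n.-1.-tuple H) (g : n.-1.-tuple K),
    ipT (tens f1 g1) (tens f2 g2) (tensor_tuple tens f g) =
    ip1 f1 f2 f * ip2 g1 g2 g.

Lemma RorC_reM (x y : RorC R k) :
  0 <= x -> 0 <= y -> RorC_re (x * y) = RorC_re x * RorC_re y.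
Proof.
case: k x y => //= -[a b] [c d] /=; rewrite !lecE /= => /andP[/eqP -> _].
by move=> /andP[/eqP -> _]; rewrite mulr0 subr0.
Qed.

Lemma RorC_re_ge0 (x : RorC R k) : 0 <= x -> 0 <= RorC_re x.
Proof. by case: k x => //= -[a b]; rewrite lecE /= => /andP[]. Qed.

(* The norm induced by [ipT] is the product norm on simple tensors. *)
Lemma nnorm_tensor : is_n_inner_product ip1 -> is_n_inner_product ip2 ->
  is_tensor_ip -> forall f1 g1 f g,
  nnorm ipT (tens f1 g1) (tensor_tuple tens f g) = nnorm ip1 f1 f * nnorm ip2 g1 g.
Proof.
move=> h1 h2 hT f1 g1 f g; rewrite /nnorm hT RorC_reM ?nip_ge0//.
by rewrite sqrtrM// RorC_re_ge0// nip_ge0.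
Qed.

Definition is_tensor_frame (a : n.-1.-tuple H) (b : n.-1.-tuple K)
    (p : nat -> H) (q : nat -> K) : Prop :=
  let ab := tensor_tuple tens a b in
  exists A B : R, [/\ 0 < A, A <= B & forall (x : H) (y : K),
    ((A * nnorm ipT (tens x y) ab ^+ 2)%:E
       <= \esum_(ij in [set: nat * nat])
            (modulus (ipT (tens x y) (tens (p ij.1) (q ij.2)) ab) ^+ 2)%:E)%E /\
    (\esum_(ij in [set: nat * nat])
        (modulus (ipT (tens x y) (tens (p ij.1) (q ij.2)) ab) ^+ 2)%:E
       <= (B * nnorm ipT (tens x y) ab ^+ 2)%:E)%E].

End Tensor.

(* Main.v *)
Require Import Defs.
From mathcomp Require Import all_boot all_order all_algebra.
From mathcomp Require Import all_classical all_reals all_analysis.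
From mathcomp Require complex.
Local Open Scope ring_scope.

(** Put [N1 x = ||x, a||^2] and [S1 x = sum_i |<x, p_i | a>|^2], and likewise
    [N2 y], [S2 y] on the other factor.  On a simple tensor the squared norm is
    [N1 x * N2 y] and, since all terms are nonnegative, the double series is the
    product [S1 x * S2 y] in the extended reals ([esum_prod]).  Two-sided bounds
    therefore multiply, so two frames give a tensor frame.

    Conversely, fix [x0] and [y0] with [N1 x0 > 0] and [N2 y0 > 0].  The tensor
    bounds at [x0] and [y0] make [S1 x0 * S2 y0] positive and finite, hence so is
    [S2 y0]; dividing the tensor bounds for [x] and [y0] by [S2 y0] bounds [S1 x]
    by multiples of [N1 x] ([two_sided_factor]).  The other factor is symmetric.

    Such a [y0] exists because [K] contains [n] independent vectors, and one
    of them can be adjoined to the [n - 1] independent vectors [b] without creating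
    a linear dependence ([steinitz_exchange]); likewise for [x0]. *)

Import Order.TTheory GRing.Theory Num.Theory.

(** If every [e i] were in the span of [b], the coordinates would form a matrix
    with more rows than columns, and a nonzero row vector annihilating it on the
    left would give a linear relation among the [e i]. *)
Lemma steinitz_exchange (F : fieldType) (V : lmodType F) (n m : nat)
    (e : n.-tuple V) (b : m.-tuple V) :
  (m < n)%N -> ~ lin_dep e -> ~ lin_dep b ->
  exists i, ~ lin_dep [tuple of tnth e i :: b].
Proof.
move=> ltmn efree bfree; apply: contrapT => noext.
have inspan i : exists M : 'I_m -> F, tnth e i = \sum_j M j *: tnth b j.
  have /contrapT[c [[j0 cj0] eqc]] : ~ ~ lin_dep [tuple of tnth e i :: b].
    by move=> h; apply: noext; exists i.
  have {eqc} : c ord0 *: tnth e i + \sum_j c (lift ord0 j) *: tnth b j = 0.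
    rewrite -[RHS]eqc big_ord_recl tnth0; congr (_ + _).
    by apply: eq_bigr => j _; rewrite tnthS.
  (* A relation without [e i] would be a relation among the [b j]. *)
  have [c00|c0] := eqVneq (c ord0) 0.
    rewrite c00 scale0r add0r => eqb; case: bfree.
    exists (fun j => c (lift ord0 j)); split=> //.
    case: (unliftP ord0 j0) cj0 => [j ->|->]; last by rewrite c00 eqxx.
    by exists j.
  move/eqP; rewrite addr_eq0 => /eqP eqe.
  exists (fun j => - ((c ord0)^-1 * c (lift ord0 j))).
  rewrite -[LHS](scalerK c0) eqe scalerN scaler_sumr -sumrN.
  by apply: eq_bigr => j _; rewrite scalerA scaleNr.
have [M eM] := boolp.choice inspan.
pose A := \matrix_(i < n, j < m) M i j.
have /rowV0Pn[v /sub_kermxP vA v0] : kermx A != 0.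
  rewrite kermx_eq0 /row_free neq_ltn (leq_ltn_trans _ ltmn)//.
  exact: rank_leq_col.
apply: efree; exists (fun i => v ord0 i); split.
  apply: contrapT => v0'; move/eqP: v0; apply; apply/rowP => i; rewrite mxE.
  by have [//|vi] := eqVneq (v ord0 i) 0; case: v0'; exists i.
under eq_bigr do rewrite eM scaler_sumr.
rewrite exchange_big big1// => j _.
under eq_bigr do rewrite scalerA.
rewrite -scaler_suml; have /rowP/(_ j) := vA; rewrite !mxE => vAj.
rewrite (eq_bigr (fun i => v ord0 i * A i j)) ?vAj ?scale0r// => i _.
by rewrite mxE.
Qed.

Section NonnegativeSeries.
Local Open Scope ereal_scope.

(** Contrary to [nneseriesZl], the factor [c] may be infinite. *)
Lemma nneseriesMr (R : realType) (f : nat -> \bar R) (c : \bar R) :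
  (forall i, 0 <= f i) -> 0 <= c ->
  \sum_(0 <= i <oo) (f i * c) = (\sum_(0 <= i <oo) f i) * c.
Proof.
move=> f0; case: c => [c||//] c0.
  under eq_eseriesr do rewrite muleC.
  by rewrite nneseriesZl// muleC.
(* Now [c = +oo]: one positive term makes both sides infinite; otherwise both
   are zero, as [0 * +oo = 0]. *)
have [[i fi]|/forallNP fN] := pselect (exists i, 0 < f i).
  rewrite (@nneseries_pinfty R (fun j => f j * +oo) xpredT i)//; last 2 first.
  - by move=> j _; rewrite mule_ge0.
  - by rewrite gt0_muley.
  rewrite gt0_muley// (lt_le_trans fi)// (@nneseriesD1 _ _ i)//.
  by rewrite leeDl// nneseries_ge0.
have fE i : f i = 0.
  by apply/eqP; rewrite eq_le f0 andbT leNgt; apply/negP/fN.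
rewrite !eseries0 ?mul0e// => i _ _; rewrite fE// mul0e//.
Qed.

Lemma esum_prod (R : realType) (f g : nat -> \bar R) :
  (forall i, 0 <= f i) -> (forall j, 0 <= g j) ->
  \esum_(ij in [set: nat * nat]) (f ij.1 * g ij.2) =
  (\sum_(0 <= i <oo) f i) * (\sum_(0 <= j <oo) g j).
Proof.
move=> f0 g0; have s0 : 0 <= \sum_(0 <= j <oo) g j by apply: nneseries_ge0.
rewrite -nneseriesMr// [RHS]nneseries_esumT; last first.
  by move=> i; rewrite mule_ge0.
have -> : [set: nat * nat]%classic = ([set: nat] `*`` (fun=> [set: nat]))%classic.
  by apply/seteqP; split.
rewrite -(@esum_esum _ _ _ _ _ (fun i j => f i * g j)); last first.
  by move=> i j _ _; rewrite mule_ge0.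
apply: eq_esum => i _; rewrite -nneseries_esumT; last first.
  by move=> j; rewrite mule_ge0.
rewrite muleC -nneseriesMr//.
by apply: eq_eseriesr => j _; rewrite muleC.
Qed.

(** [S] lies between two positive multiples of [N]; a frame is the case where
    [N] is the squared norm and [S] the series of squared coefficients. *)
Definition two_sided (R : realType) (X : Type) (N : X -> R) (S : X -> \bar R) :=
  exists A B : R, [/\ (0 < A)%R, (A <= B)%R & forall x : X,
    (A * N x)%:E <= S x /\ S x <= (B * N x)%:E].

Lemma two_sided_prod (R : realType) (X Y : Type) (N1 : X -> R) (N2 : Y -> R)
    (S1 : X -> \bar R) (S2 : Y -> \bar R) :
  (forall x, 0 <= N1 x)%R -> (forall y, 0 <= N2 y)%R ->
  (forall x, 0 <= S1 x) -> (forall y, 0 <= S2 y) ->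
  two_sided R X N1 S1 -> two_sided R Y N2 S2 ->
  two_sided R (X * Y) (fun z => N1 z.1 * N2 z.2)%R (fun z => S1 z.1 * S2 z.2).
Proof.
move=> N10 N20 S10 S20 [A1 [B1 [A10 AB1 h1]]] [A2 [B2 [A20 AB2 h2]]].
exists (A1 * A2)%R, (B1 * B2)%R; split.
- by rewrite mulr_gt0.
- by rewrite ler_pM// ltW.
- move=> [x y] /=; have [l1 u1] := h1 x; have [l2 u2] := h2 y.
  by split; rewrite mulrACA EFinM lee_pmul// lee_fin mulr_ge0// ltW.
Qed.

Lemma two_sided_factor (R : realType) (X Y : Type) (N1 : X -> R) (N2 : Y -> R)
    (S1 : X -> \bar R) (S2 : Y -> \bar R) (x0 : X) (y0 : Y) :
  (0 < N1 x0)%R -> (0 < N2 y0)%R ->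
  (forall x, 0 <= S1 x) -> (forall y, 0 <= S2 y) ->
  two_sided R (X * Y) (fun z => N1 z.1 * N2 z.2)%R (fun z => S1 z.1 * S2 z.2) ->
  two_sided R X N1 S1.
Proof.
move=> N1x N2y S10 S20 [A [B [A0 AB h]]].
have [c c0 Sc] : exists2 c : R, (0 < c)%R & S2 y0 = c%:E.
  have [/= lo up] := h (x0, y0).
  have pos : 0 < S1 x0 * S2 y0.
    by apply: lt_le_trans lo; rewrite lte_fin !mulr_gt0.
  have S1x : 0 < S1 x0.
    by rewrite lt0e S10 andbT; apply: contraTneq pos => ->; rewrite mul0e ltxx.
  have S2y : 0 < S2 y0.
    by rewrite lt0e S20 andbT; apply: contraTneq pos => ->; rewrite mule0 ltxx.
  (* If [S2 y0] were infinite, so would be [S1 x0 * S2 y0], against [up]. *)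
  case: (S2 y0) S2y up => [c c0 _|_|//]; first by exists c.
  by rewrite gt0_muley.
have A'0 : (0 < c^-1 * (A * N2 y0))%R by rewrite !mulr_gt0// invr_gt0.
exists (c^-1 * (A * N2 y0))%R, (c^-1 * (B * N2 y0))%R; split=> //.
  by rewrite ler_pM2l ?invr_gt0// ler_pM2r.
move=> x; have [/= lo up] := h (x, y0); split.
  rewrite -!mulrA EFinM lee_pdivrMl// -Sc (muleC (S2 y0)).
  by rewrite [(N2 y0 * _)%R]mulrC.
rewrite -!mulrA EFinM lee_pdivlMl// -Sc (muleC (S2 y0)).
by rewrite [(N2 y0 * _)%R]mulrC.
Qed.

End NonnegativeSeries.

Lemma modulusM (R : realType) (k : base_field) (z w : RorC R k) :
  modulus (z * w) = modulus z * modulus w.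
Proof. by rewrite /modulus normrM RorC_reM. Qed.

Lemma RorC_re_gt0 (R : realType) (k : base_field) (z : RorC R k) :
  0 <= z -> z != 0 -> 0 < RorC_re z.
Proof.
case: k z => /= [z z0 zn0|[u v]]; first by rewrite lt0r zn0.
rewrite complex.lecE complex.eq_complex/= => /andP[/eqP -> u0].
by rewrite eqxx andbT => un0; rewrite lt0r un0.
Qed.

Lemma exists_nnorm_gt0 (R : realType) (k : base_field) (n : nat)
    (H : lmodType (RorC R k)) (ip : H -> H -> n.-1.-tuple H -> RorC R k)
    (a : n.-1.-tuple H) :
  (0 < n)%N -> is_n_inner_product ip -> ~ lin_dep a ->
  exists x, 0 < nnorm ip x a ^+ 2.
Proof.
move=> n0 hip afree; have [e efree] := nip_dim hip.
have [|i ext] := @steinitz_exchange _ _ _ _ e a _ efree afree.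
  by rewrite ltn_predL.
exists (tnth e i); rewrite exprn_gt0// sqrtr_gt0 RorC_re_gt0//.
  exact: nip_ge0.
by apply/eqP => /(nip_eq0 hip).
Qed.

Theorem theorem3p8 (R : realType) (k : base_field) (n : nat) (hn : (2 <= n)%N)
  (H K T : lmodType (RorC R k)) (tens : {bilinear H -> K -> T})
  (ip1 : H -> H -> n.-1.-tuple H -> RorC R k)
  (ip2 : K -> K -> n.-1.-tuple K -> RorC R k)
  (ipT : T -> T -> n.-1.-tuple T -> RorC R k)
  (hH : is_n_hilbert ip1) (hK : is_n_hilbert ip2)
  (hT : is_tensor_product tens) (hipT : is_tensor_ip tens ip1 ip2 ipT)
  (a : n.-1.-tuple H) (b : n.-1.-tuple K)
  (ha : ~ lin_dep a) (hb : ~ lin_dep b)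
  (p : nat -> H) (q : nat -> K) :
  is_tensor_frame tens ipT a b p q <-> is_frame ip1 a p /\ is_frame ip2 b q.
Proof.
have [[hip1 _] [hip2 _]] := (hH, hK).
pose N1 x := nnorm ip1 x a ^+ 2; pose N2 y := nnorm ip2 y b ^+ 2.
pose S1 x := (\sum_(0 <= i <oo) (modulus (ip1 x (p i) a) ^+ 2)%:E)%E.
pose S2 y := (\sum_(0 <= j <oo) (modulus (ip2 y (q j) b) ^+ 2)%:E)%E.
have N10 x : 0 <= N1 x by exact: sqr_ge0.
have N20 y : 0 <= N2 y by exact: sqr_ge0.
have S10 x : (0 <= S1 x)%E.
  by apply: nneseries_ge0 => i _ _; rewrite lee_fin sqr_ge0.
have S20 y : (0 <= S2 y)%E.
  by apply: nneseries_ge0 => j _ _; rewrite lee_fin sqr_ge0.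
have n0 : (0 < n)%N by exact: ltnW.
have [x0 N1x0] : exists x, 0 < N1 x := exists_nnorm_gt0 R k n H ip1 a n0 hip1 ha.
have [y0 N2y0] : exists y, 0 < N2 y := exists_nnorm_gt0 R k n K ip2 b n0 hip2 hb.
have normE x y :
    nnorm ipT (tens x y) (tensor_tuple tens a b) ^+ 2 = N1 x * N2 y.
  by rewrite (nnorm_tensor hip1 hip2 hipT) exprMn.
have sumE x y : \esum_(ij in [set: nat * nat])
    (modulus (ipT (tens x y) (tens (p ij.1) (q ij.2)) (tensor_tuple tens a b))
       ^+ 2)%:E = (S1 x * S2 y)%E.
  rewrite -esum_prod => [|i|j]; rewrite ?lee_fin ?sqr_ge0//.
  by apply: eq_esum => ij _; rewrite hipT modulusM exprMn EFinM.
have tensE : is_tensor_frame tens ipT a b p q <->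
    two_sided R (H * K) (fun z => N1 z.1 * N2 z.2)
      (fun z => S1 z.1 * S2 z.2)%E.
  split=> -[A [B [A0 AB h]]]; exists A, B; split=> //.
    by move=> [x y]; have := h x y; rewrite normE sumE.
  by move=> x y; rewrite normE sumE; exact: (h (x, y)).
split=> [/tensE hprod|[h1 h2]]; last by apply/tensE; exact: two_sided_prod.
split; first exact: (@two_sided_factor _ _ _ N1 N2 S1 S2 x0 y0) N1x0 N2y0 S10 S20 hprod.
apply: (@two_sided_factor _ _ _ N2 N1 S2 S1 y0 x0) N2y0 N1x0 S20 S10 _.
have [A [B [A0 AB h]]] := hprod; exists A, B; split=> // -[y x] /=.
by rewrite [N2 y * N1 x]mulrC [(S2 y * S1 x)%E]muleC; exact: (h (x, y)).
Qed.
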